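(* Let $k\geqslant 1$ be an integer and let $G$ be an arbitrary graph with $|V(G)|\geqslant k$. Then $$\gamma_{k\text{-SRD}}(G)\leqslant\gamma_{kR}(G).$$
   Context: All graphs are finite, simple and undirected; $N(v)$ denotes the set of neighbors of $v$ and $\Delta(G)$ the maximum degree. Let $k\geqslant 1$ be an integer with $|V(G)|\geqslant k$. An attack pattern is a set $P\subseteq V(G)$ with $|P|=k$. A function $f:V(G)\to\{0,1,\ldots,\min(\Delta(G),k)+1\}$ is a proper $k$-SRD ($k$-strong Roman domination) function if for each attack pattern $P$ every vertex $u\in P$ with $f(u)=0$ can be defended by a neighboring vertex, where each vertex $v$ with $f(v)\geqslant 2$ can defend at most $f(v)-1$ of its neighbors in $P$ labeled 0 (and vertices with label $\leqslant 1$ defend no other vertex). That is, for each $P$ there is a map $\delta_P:\{u\in P : f(u)=0\}\to V(G)$ (which may depend on $P$) such that $\delta_P(u)\in N(u)$ and $f(\delta_P(u))\geqslant 2$ for all $u$ in its domain, and $|\delta_P^{-1}(v)|\leqslant f(v)-1$ for every $v$ with $f(v)\geqslant 2$. The weight is $\omega(f)=\sum_{v\in V(G)}f(v)$, and the $k$-SRD number is $\gamma_{k\text{-SRD}}(G)=\min\{\omega(f) : f \text{ is a proper } k\text{-SRD function on } G\}$. A Roman $k$-dominating function on $G$ is a function $f:V(G)\to\{0,1,2\}$ such that every vertex labeled 0 is adjacent to at least $k$ vertices labeled 2. The Roman $k$-domination number $\gamma_{kR}(G)$ is the minimum weight $\sum_{v\in V(G)}f(v)$ of a Roman $k$-dominating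 function on $G$. *)

(* Defs.v *)
From HB Require Import structures.
From mathcomp Require Import all_boot.

Set Implicit Arguments.
Unset Strict Implicit.
Unset Printing Implicit Defensive.

Record sgraph := SGraph {
  svertex :> finType;
  sedge : rel svertex;
  sedge_sym : symmetric sedge;
  sedge_irrefl : irreflexive sedge }.

Section RomanDomination.

Variable G : sgraph.

Definition nbhd (v : G) : {set G} := [set u | sedge v u].

Definition max_degree : nat := \max_(v : G) #|nbhd v|.

Definition weight (m : nat) (f : {ffun G -> 'I_m}) : nat := \sum_(v : G) f v.

Section StrongRoman.

Variable k : nat.

Definition srd_labeling : predArgType :=
  {ffun G -> 'I_(minn max_degree k).+2}.

Definition attacked0 (f : srd_labeling) (P : {set G}) : {set G} :=
  [set u in P | f u == 0 :> nat].

(* The defence map is encoded as a total function, of which only the values on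
   [attacked0 f P] matter: both conditions are restricted to that set. *)
Definition defence (f : srd_labeling) (P : {set G}) (d : {ffun G -> G}) : bool :=
  [forall u in attacked0 f P, (d u \in nbhd u) && (2 <= f (d u))] &&
  [forall v : G, (2 <= f v) ==>
     (#|[set u in attacked0 f P | d u == v]| <= f v - 1)].

Definition proper_srd (f : srd_labeling) : bool :=
  [forall P : {set G}, (#|P| == k) ==>
     [exists d : {ffun G -> G}, defence f P d]].

Lemma srd_weight_exists :
  exists n, [exists f : srd_labeling, proper_srd f && (weight f == n)].
Proof.
pose f1 : srd_labeling := [ffun=> inord 1].
have f1E u : f1 u = 1 :> nat by rewrite ffunE inordK.
exists (weight f1); apply/existsP; exists f1; rewrite eqxx andbT.
apply/forallP => P; apply/implyP => _; apply/existsP; exists [ffun u => u].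
apply/andP; split; first by apply/forall_inP => u; rewrite inE f1E andbF.
by apply/forallP => v; rewrite f1E.
Qed.

Definition srd_number : nat := ex_minn srd_weight_exists.

End StrongRoman.

Section RomanK.

Variable k : nat.

Definition roman_kdominating (f : {ffun G -> 'I_3}) : bool :=
  [forall v : G, (f v == 0 :> nat) ==>
     (k <= #|[set u in nbhd v | f u == 2 :> nat]|)].

Lemma roman_weight_exists :
  exists n, [exists f : {ffun G -> 'I_3},
               roman_kdominating f && (weight f == n)].
Proof.
pose f1 : {ffun G -> 'I_3} := [ffun=> inord 1].
exists (weight f1); apply/existsP; exists f1; rewrite eqxx andbT.
by apply/forallP => v; rewrite ffunE inordK.
Qed.

Definition roman_kdom_number : nat := ex_minn roman_weight_exists.

End RomanK.

End RomanDomination.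

(* Main.v *)
Require Import Defs.
From mathcomp Require Import all_boot.

(** If every vertex labelled 0 has at least [k] neighbours labelled 2, then the
    at most [k] attacked vertices labelled 0 can greedily be assigned pairwise
    distinct defenders labelled 2, each of which defends only one vertex. *)

Lemma distinct_representatives (S T : finType) (A : {set S}) (N : S -> {set T})
    (t0 : T) :
  {in A, forall u, #|A| <= #|N u|} ->
  exists d : {ffun S -> T},
    {in A, forall u, d u \in N u} /\ {in A &, injective d}.
Proof.
move cardA: #|A| => n; elim: n A cardA => [|n IHn] A cardA leN.
  exists [ffun=> t0]; rewrite (cards0_eq cardA).
  by split=> [u|u w]; rewrite inE.
have [x xA]: exists x, x \in A by apply/card_gt0P; rewrite cardA.
have cardAx: #|A :\ x| = n by move: cardA; rewrite (cardsD1 x) xA => -[].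
have [|d [dN dI]] := IHn _ cardAx.
  by move=> u /setD1P[_ uA]; apply/ltnW/leN.
(* The representatives of [A :\ x] number at most [n], so they cannot exhaust [N x], which has at
   least [n.+1] elements. *)
have [y]: exists y, y \in N x :\: d @: (A :\ x).
  apply/card_gt0P; rewrite cardsD subn_gt0.
  apply: leq_trans (leN x xA); rewrite ltnS.
  apply: leq_trans (subset_leq_card (subsetIr _ _)) _.
  by rewrite -cardAx leq_imset_card.
case/setDP=> yN y_new.
have d_neq u : u \in A -> u != x -> d u != y.
  move=> uA ux; apply: contraNneq y_new => <-.
  by apply: imset_f; rewrite !inE ux.
exists [ffun u => if u == x then y else d u]; split=> [u uA|u w uA wA].
  by rewrite ffunE; case: eqVneq => [->|ux] //; apply: dN; rewrite !inE ux.
rewrite !ffunE; case: eqVneq => [->|ux]; case: eqVneq => [->|wx] //.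
- by move/esym/eqP; rewrite (negPf (d_neq w wA wx)).
- by move/eqP; rewrite (negPf (d_neq u uA ux)).
- by apply: dI; rewrite !inE ?ux ?wx.
Qed.

(* Labels of an SRD function are at most [minn (max_degree G) k + 1], which can
   be smaller than 2; the truncation is harmless, since it only takes effect
   when no vertex is labelled 0. *)
Definition truncate_labels (G : sgraph) (k : nat) (f : {ffun G -> 'I_3}) :
    srd_labeling G k :=
  [ffun v => inord (minn (f v) (minn (max_degree G) k).+1)].

Lemma truncate_labelsE (G : sgraph) (k : nat) (f : {ffun G -> 'I_3}) (v : G) :
  truncate_labels G k f v = minn (f v) (minn (max_degree G) k).+1 :> nat.
Proof. by rewrite ffunE inordK // ltnS geq_minr. Qed.

Lemma weight_truncate_labels (G : sgraph) (k : nat) (f : {ffun G -> 'I_3}) :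
  weight (truncate_labels G k f) <= weight f.
Proof. by apply: leq_sum => v _; rewrite truncate_labelsE geq_minl. Qed.

(** The vertex [u] has at least [k] neighbors labelled 2. Hence, for positive [k], the cap on labels
    is at least 2 as soon as a label 0 occurs. *)
Lemma roman_kdominating_max_degree {G : sgraph} {k : nat}
    {f : {ffun G -> 'I_3}} {u : G} :
  roman_kdominating k f -> f u = 0 :> nat -> k <= max_degree G.
Proof.
move=> /forallP/(_ u)/implyP domf /eqP/domf lek.
have ledeg : #|nbhd u| <= max_degree G by apply: leq_bigmax.
apply: leq_trans lek (leq_trans _ ledeg).
by apply/subset_leq_card/subsetP => w; rewrite inE => /andP[].
Qed.

Lemma proper_truncate_labels {G : sgraph} {k : nat} {f : {ffun G -> 'I_3}} :
  0 < k -> roman_kdominating k f -> proper_srd (truncate_labels G k f).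
Proof.
move=> k_gt0 domf; apply/forallP => P; apply/implyP => /eqP cardP.
set g := truncate_labels G k f; set A := attacked0 g P.
(* The cap is a successor, so truncation never turns a positive label into 0. *)
have fA u : u \in A -> f u = 0 :> nat.
  rewrite inE truncate_labelsE => /andP[_].
  by case: (nat_of_ord (f u)) => // m; rewrite minnSS.
have g2 u w : u \in A -> f w = 2 :> nat -> g w = 2 :> nat.
  move=> uA fw; rewrite truncate_labelsE fw; apply/minn_idPl.
  by rewrite ltnS leq_min k_gt0 (leq_trans k_gt0) //
     (roman_kdominating_max_degree domf (fA _ uA)).
(* With nothing to defend, any map works; otherwise an element of [A] provides the default value for
   the choice of representatives. *)
have [A0|[t0 t0A]] := set_0Vmem A.
  apply/existsP; exists [ffun u => u]; apply/andP; split.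
    by apply/forall_inP => u; rewrite -/A A0 inE.
  apply/forall_inP => v _; rewrite -/A A0.
  by rewrite eq_card0 // => u; rewrite !inE.
pose N u := [set w in nbhd u | f w == 2 :> nat].
have leN : {in A, forall u, #|A| <= #|N u|}.
  move=> u uA; apply: (@leq_trans k).
    by rewrite -cardP; apply/subset_leq_card/subsetP => w; rewrite inE => /andP[].
  by move/forallP/(_ u)/implyP: domf; apply; rewrite fA.
have [d [dN dI]] := @distinct_representatives _ _ A N t0 leN.
apply/existsP; exists d; apply/andP; split.
  apply/forall_inP => u uA; have := dN u uA.
  by rewrite inE => /andP[-> /eqP/(g2 u _ uA) ->].
(* Injectivity of [d] on [A] leaves each [v] at most one vertex to defend, and a label of at least 2
   allows one. *)
apply/forall_inP => v gv; apply: (@leq_trans 1); last by rewrite subn_gt0.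
apply/card_le1_eqP => u w /setIdP[uA /eqP du] /setIdP[wA /eqP dw].
by apply: (dI _ _ wA uA); rewrite du dw.
Qed.

Theorem proposition4 (k : nat) (G : sgraph) (hk : 1 <= k) (hG : k <= #|G|) :
  srd_number G k <= roman_kdom_number G k.
Proof.
rewrite /roman_kdom_number.
case: ex_minnP => _ /existsP[f /andP[domf /eqP<-]] _.
apply: leq_trans (weight_truncate_labels G k f).
rewrite /srd_number; case: ex_minnP => m _; apply.
apply/existsP; exists (truncate_labels G k f).
by rewrite eqxx (proper_truncate_labels hk domf).
Qed.
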